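(* For all particles $j=1,\dots,J$, as $i\to\infty$, $\mathbf P\widetilde{\mathbf v}_{i+1}^{(j)}\to\mathbf P\widetilde{\mathbf v}_\infty^{(j)}=\mathbf P\mathbf v_\star^{(j)}$, where $\widetilde{\mathbf v}_\infty^{(j)}=\lim_{i\to\infty}\widetilde{\mathbf v}_{i+1}^{(j)}$; and $\mathbf P\widetilde{\mathbf v}_{i+1}^{(j)}$ converges in distribution to $$\mathcal N\big(\mathbf P\mathbf v^\star,\ \mathbf P(\mathbf H^\top\boldsymbol\Gamma^{-1}\mathbf H)^\dagger\mathbf P^\top\big).$$
   Context: Let $\mathbf H\in\mathbb R^{n\times d}$, $\boldsymbol\Gamma\in\mathbb R^{n\times n}$ symmetric positive definite, $\mathbf y\in\mathbb R^n$, $\boldsymbol\mu_0\in\mathbb R^d$, and $\widetilde{\mathbf C}_0\in\mathbb R^{d\times d}$ symmetric positive semidefinite. Let $\dagger$ be the Moore–Penrose pseudoinverse and $\mathbf H^+=(\mathbf H^\top\boldsymbol\Gamma^{-1}\mathbf H)^\dagger\mathbf H^\top\boldsymbol\Gamma^{-1}$. For $j=1,\dots,J$ the initial particles $\mathbf v_0^{(j)}\in\mathbb R^d$ are random with mean $\boldsymbol\mu_0$ and covariance $\widetilde{\mathbf C}_0$; the perturbations $\boldsymbol\varepsilon^{(j)}\sim\mathcal N(\mathbf 0,\boldsymbol\Gamma)$ are i.i.d. and independent of the initial particles; $\mathbf y^{(j)}=\mathbf y+\boldsymbol\varepsilon^{(j)}$, $\mathbf v_\star^{(j)}=\mathbf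 H^+\mathbf y^{(j)}$ (the randomized maximum likelihood estimator) and $\mathbf v^\star=\mathbf H^+\mathbf y$. Mean-field iteration: for $i\ge 0$ define recursively $$\widetilde{\mathbf M}_i=\big(\mathbf I+\widetilde{\mathbf C}_i\mathbf H^\top\boldsymbol\Gamma^{-1}\mathbf H\big)^{-1},\qquad \widetilde{\mathbf M}_{i:0}=\widetilde{\mathbf M}_i\cdots\widetilde{\mathbf M}_0,$$ $$\widetilde{\mathbf C}_{i+1}=\widetilde{\mathbf M}_{i:0}\widetilde{\mathbf C}_0\widetilde{\mathbf M}_{i:0}^\top+(\mathbf I-\widetilde{\mathbf M}_{i:0})(\mathbf H^\top\boldsymbol\Gamma^{-1}\mathbf H)^\dagger(\mathbf I-\widetilde{\mathbf M}_{i:0})^\top.$$ The mean-field particles are $\widetilde{\mathbf v}_{i+1}^{(j)}=\widetilde{\mathbf M}_{i:0}\mathbf v_0^{(j)}+(\mathbf I-\widetilde{\mathbf M}_{i:0})\mathbf v_\star^{(j)}$. The eigenvectors of $\widetilde{\mathbf C}_i\mathbf H^\top\boldsymbol\Gamma^{-1}\mathbf H$ can be taken independent of $i$; write $\widetilde{\mathbf C}_i\mathbf H^\top\boldsymbol\Gamma^{-1}\mathbf H\,\mathbf u_\ell=\lambda_{\ell,i}\mathbf u_\ell$. Let $r$ be the number of strictly positive eigenvalues (independent of $i$), indexed so that $\lambda_{1,1}\ge\cdots\ge\lambda_{r,1}>0$, and $\mathbf U=[\mathbf u_1,\dots,\mathbf u_r]$ the matrix of corresponding eigenvectors, normalized so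 that $\mathbf U^\top\mathbf H^\top\boldsymbol\Gamma^{-1}\mathbf H\mathbf U=\mathbf I_r$. Set $\mathbf P=\mathbf U\mathbf U^\top\mathbf H^\top\boldsymbol\Gamma^{-1}\mathbf H$. A Gaussian law with singular covariance is allowed. *)

(* Defs.v *)
From HB Require Import structures.
From mathcomp Require Import all_boot all_order all_algebra.
From mathcomp Require Import all_classical all_reals all_analysis.

Set Implicit Arguments.
Unset Strict Implicit.
Unset Printing Implicit Defensive.

Import Order.TTheory GRing.Theory Num.Theory.
Import numFieldNormedType.Exports.

Local Open Scope classical_set_scope.
Local Open Scope ring_scope.

Section LinearAlgebra.
Context {R : realType}.

Definition possemidef k (S : 'M[R]_k) : Prop :=
  S^T = S /\ forall x : 'cV[R]_k, 0 <= (x^T *m S *m x) 0 0.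

Definition posdef k (S : 'M[R]_k) : Prop :=
  S^T = S /\ forall x : 'cV[R]_k, x != 0 -> 0 < (x^T *m S *m x) 0 0.

Definition is_pinv m k (A : 'M[R]_(m, k)) (X : 'M[R]_(k, m)) : Prop :=
  [/\ A *m X *m A = A, X *m A *m X = X,
      (A *m X)^T = A *m X & (X *m A)^T = X *m A].

Definition pinvMP m k (A : 'M[R]_(m, k)) : 'M[R]_(k, m) :=
  xget 0 [set X | is_pinv A X].

Lemma gram_unitmx m k (B : 'M[R]_(m, k)) :
  row_free B -> B *m B^T \in unitmx.
Proof.
move=> fB; rewrite -row_free_unit -kermx_eq0; apply/eqP/row_matrixP => i.
rewrite row0; set x := row i _.
have xBB : x *m (B *m B^T) = 0.
  by rewrite /x -row_mul mulmx_ker row0.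
have xB0 : x *m B = 0.
  have : (x *m B) *m (x *m B)^T = 0 by rewrite trmx_mul !mulmxA -(mulmxA x) xBB mul0mx.
  move=> /matrixP /(_ 0 0); rewrite !mxE => /eqP.
  rewrite psumr_eq0 => [|l _]; last by rewrite [X in _ * X]mxE -expr2 sqr_ge0.
  move=> /allP h; apply/rowP => l; rewrite [RHS]mxE.
  have := h l (mem_index_enum l); rewrite [X in _ * X]mxE -expr2 sqrf_eq0.
  by move/eqP.
by apply: (row_free_inj fB); rewrite mul0mx.
Qed.

Lemma is_pinv_ex m k (A : 'M[R]_(m, k)) : exists X, is_pinv A X.
Proof.
have [r [C [B [AE uC uB]]]] : exists r (C : 'M[R]_(m, r)) (B : 'M[R]_(r, k)),
    [/\ A = C *m B, C^T *m C \in unitmx & B *m B^T \in unitmx].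
  exists (\rank A), (col_base A), (row_base A); split.
  - by rewrite mulmx_base.
  - have := @gram_unitmx _ _ (col_base A)^T; rewrite trmxK; apply.
    by rewrite /row_free mxrank_tr; exact: col_base_full.
  - by apply: gram_unitmx; exact: row_base_free.
pose X := B^T *m invmx (B *m B^T) *m (invmx (C^T *m C) *m C^T).
have AX : A *m X = C *m invmx (C^T *m C) *m C^T.
  by rewrite AE /X !mulmxA -(mulmxA C B) mulmxK.
have XA : X *m A = B^T *m invmx (B *m B^T) *m B.
  by rewrite AE /X !mulmxA -(mulmxA _ C^T C) mulmxKV.
exists X; split.
- by rewrite AX AE !mulmxA -(mulmxA _ C^T C) mulmxKV.
- by rewrite XA /X !mulmxA -(mulmxA _ B B^T) mulmxKV.
- by rewrite AX !trmx_mul trmxK trmx_inv trmx_mul trmxK mulmxA.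
- by rewrite XA !trmx_mul trmxK trmx_inv trmx_mul trmxK mulmxA.
Qed.

Lemma is_pinv_uniq m k (A : 'M[R]_(m, k)) X Y :
  is_pinv A X -> is_pinv A Y -> X = Y.
Proof.
move=> [AXA XAX AXs XAs] [AYA YAY AYs YAs].
have AXY : A *m X = A *m Y.
  rewrite -AXs -[A in LHS]AYA -(mulmxA (A *m Y)) trmx_mul AXs AYs.
  by rewrite mulmxA AXA.
have XYA : X *m A = Y *m A.
  rewrite -XAs -[A in LHS]AYA !mulmxA -(mulmxA (X *m A)) trmx_mul XAs YAs.
  by rewrite -mulmxA (mulmxA A) AXA.
by rewrite -XAX XYA -mulmxA AXY mulmxA YAY.
Qed.

Lemma pinvMPP m k (A : 'M[R]_(m, k)) : is_pinv A (pinvMP A).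
Proof. by have [X AX] := is_pinv_ex A; exact: (xgetI _ AX). Qed.

End LinearAlgebra.

Section MeanField.
Context {R : realType} {n d : nat}.
Variables (H : 'M[R]_(n, d)) (G : 'M[R]_n) (C0 : 'M[R]_d).

Definition obs_info : 'M[R]_d := H^T *m invmx G *m H.

Definition wpinv : 'M[R]_(d, n) := pinvMP obs_info *m H^T *m invmx G.

(* Step [i] carries the pair (C_i, M_{i-1} ... M_0), the product being empty
   for [i = 0]. *)
Fixpoint mf_state (i : nat) : 'M[R]_d * 'M[R]_d :=
  if i is i'.+1 then
    let: (C, N) := mf_state i' in
    let N' := invmx (1%:M + C *m obs_info) *m N in
    (N' *m C0 *m N'^T
       + (1%:M - N') *m pinvMP obs_info *m (1%:M - N')^T, N')
  else (C0, 1%:M).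

Definition mf_cov (i : nat) : 'M[R]_d := (mf_state i).1.

Definition mf_step (i : nat) : 'M[R]_d :=
  invmx (1%:M + mf_cov i *m obs_info).

(* M_i M_{i-1} ... M_0 *)
Definition mf_prod (i : nat) : 'M[R]_d := (mf_state i.+1).2.

Lemma mf_cov0 : mf_cov 0 = C0. Proof. by []. Qed.

Lemma mf_covS i : mf_cov i.+1 =
  mf_prod i *m C0 *m (mf_prod i)^T
    + (1%:M - mf_prod i) *m pinvMP obs_info *m (1%:M - mf_prod i)^T.
Proof. by rewrite /mf_cov /mf_prod /=; case: mf_state. Qed.

Lemma mf_prod0 : mf_prod 0 = mf_step 0.
Proof. by rewrite /mf_prod /mf_step /= mulmx1. Qed.

Lemma mf_prodS i : mf_prod i.+1 = mf_step i.+1 *m mf_prod i.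
Proof. by rewrite /mf_prod /mf_step /mf_cov /=; case: mf_state. Qed.

Definition mf_particle (v0 vstar : 'cV[R]_d) (i : nat) : 'cV[R]_d :=
  if i is i'.+1 then mf_prod i' *m v0 + (1%:M - mf_prod i') *m vstar else v0.

Definition leading_cols r (hr : (r <= d)%N) (W : 'M[R]_d) : 'M[R]_(d, r) :=
  colsub (widen_ord hr) W.

(* The columns of [W] are the eigenvectors common to all the C_i A, where
   A = [obs_info]; they form a basis of R^d, so that counting the positive
   [lam i l] counts the positive eigenvalues of C_i A with multiplicity. *)
Record mf_eigensystem (W : 'M[R]_d) (lam : nat -> 'I_d -> R)
    (r : nat) (hr : (r <= d)%N) : Prop := MfEigensystem {
  eigen_basis : W \in unitmx;
  eigen_eq : forall (i : nat) (l : 'I_d),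
    mf_cov i *m obs_info *m col l W = lam i l *: col l W;
  eigen_count : forall i : nat, #|[set l : 'I_d | 0 < lam i l]%SET| = r;
  eigen_pos : forall (i : nat) (l : 'I_d), (l < r)%N -> 0 < lam i l;
  eigen_sorted : forall k l : 'I_d,
    (k <= l)%N -> (l < r)%N -> lam 1%N l <= lam 1%N k;
  eigen_normalized :
    (leading_cols hr W)^T *m obs_info *m leading_cols hr W = 1%:M
}.

Definition mf_proj r (U : 'M[R]_(d, r)) : 'M[R]_d := U *m U^T *m obs_info.

End MeanField.

(* R^k with its Borel sigma-algebra *)
Definition Rvec (R : realType) (k : nat) :=
  g_sigma_algebraType (@open 'cV[R]_k).

(* N(m, v) on the line, [v] being the variance. The library's [normal_prob]
   takes the standard deviation, and is not a point mass when it is 0. *)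
Definition gauss1 {R : realType} (m v : R) (B : set R) : \bar R :=
  if v == 0 then \d_m B else normal_prob m (Num.sqrt v) B.

(* [nu] is the law N(m, S), [S] possibly singular: every linear functional
   [x |-> a^T x] has law N(a^T m, a^T S a). *)
Definition gaussian_law {R : realType} {k : nat} (nu : set (Rvec R k) -> \bar R)
    (m : 'cV[R]_k) (S : 'M[R]_k) : Prop :=
  forall (a : 'cV[R]_k) (B : set R), measurable B ->
    nu [set x : 'cV[R]_k | B ((a^T *m x) 0 0)] =
    gauss1 ((a^T *m m) 0 0) ((a^T *m S *m a) 0 0) B.

Section RandomVectors.
Context {disp : measure_display} {T : measurableType disp} {R : realType}.
Variable P : probability T R.

Definition has_mean k (X : {RV P >-> Rvec R k}) (m : 'cV[R]_k) : Prop :=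
  forall a : 'I_k, ('E_P[(fun w => ((X w : 'cV[R]_k) a 0)%R)] = (m a 0%R)%:E)%E.

Definition has_covariance k (X : {RV P >-> Rvec R k}) (S : 'M[R]_k) : Prop :=
  forall a b : 'I_k,
    covariance P (fun w => (X w : 'cV[R]_k) a 0)
                 (fun w => (X w : 'cV[R]_k) b 0) = (S a b)%:E.

Definition mutually_independent J k (X : 'I_J -> {RV P >-> Rvec R k}) : Prop :=
  forall (S : {set 'I_J}) (B : 'I_J -> set (Rvec R k)),
    (forall j, measurable (B j)) ->
    P (\bigcap_(j in [set` S]) (X j @^-1` B j)) =
    (\prod_(j in S) P (X j @^-1` B j))%E.

Definition independent_families J K k l (X : 'I_J -> {RV P >-> Rvec R k})
    (Y : 'I_K -> {RV P >-> Rvec R l}) : Prop :=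
  forall A B : set T,
    g_sigma_preimage (fun j => X j : T -> Rvec R k) A ->
    g_sigma_preimage (fun j => Y j : T -> Rvec R l) B ->
    (P (A `&` B) = P A * P B)%E.

(* weak convergence of the laws of [X i] to [nu] *)
Definition cvg_in_distribution k (X : nat -> T -> 'cV[R]_k)
    (nu : probability (Rvec R k) R) : Prop :=
  (forall i, measurable_fun [set: T] (X i : T -> Rvec R k)) /\
  forall f : 'cV[R]_k -> R, continuous f ->
    (exists M : R, forall x, `|f x| <= M) ->
    (\int[P]_w (f (X i w))%:E)%E @[i --> \oo] -->
      (\int[nu]_x (f x)%:E)%E.

End RandomVectors.

(* Main.v *)
Require Import Defs.
From HB Require Import structures.
From mathcomp Require Import all_boot all_order all_algebra.
From mathcomp Require Import all_classical all_reals all_analysis.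
From mathcomp Require Import measurable_realfun.

Set Implicit Arguments.
Unset Strict Implicit.
Unset Printing Implicit Defensive.

Import Order.TTheory GRing.Theory Num.Theory.
Import numFieldNormedType.Exports.

Local Open Scope classical_set_scope.
Local Open Scope ring_scope.

(** Write A = H^T G^-1 H, let w_l be the common eigenvectors (the columns of W)
    and lam i l the eigenvalues of C_i A.  Everything rests on the fact that the
    matrix recursion is diagonal in the basis W.

    The C_i are positive semidefinite, so no lam i l is negative, and the
    counting hypothesis forces lam i l = 0 for r <= l.  Hence I + C_i A is
    invertible and M_i ... M_0 multiplies w_l by
    decay i l = prod_(k <= i) 1 / (1 + lam k l) ([prod_eigvec]).  For r <= l
    this factor is 1.  For l < r, evaluating the covariance recursion on A w_l,
    where A is self-adjoint for M_i ... M_0 and A A^+ A = A, gives the scalar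
    recursion
      lam (i+1) l = (decay i l)^2 lam 0 l + (1 - decay i l)^2   ([eigval_rec]).
    As decay i l <= decay 0 l < 1, the eigenvalues stay above the positive
    constant (1 - decay 0 l)^2, so decay i l tends to 0 geometrically
    ([decay_cvg0]).

    So M_i ... M_0 converges to the projection onto the span of the w_l with
    r <= l along the others, and the particles converge, for every outcome, to
    vstar plus the part of v0 - vstar in that span.  Eigenvectors for zero and
    nonzero eigenvalues are A-orthogonal, so the projector P = U U^T A kills that
    span ([proj_eigvec]); this identifies P v_oo with P vstar.

    For the law, P vstar = P H^+ (y + eps) is an affine image of a Gaussian
    vector ([gaussian_law_affine]), with covariance
    P H^+ G (H^+)^T P^T = P A^+ P^T ([wpinv_cov]); and convergence for every
    outcome gives convergence in distribution by dominated convergence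
    ([cvg_pointwise_in_distribution]). *)

(** * Positive matrices, pseudoinverses and eigenvectors *)

Section PositiveMatrices.
Context {R : realType}.

Lemma possemidef_congr k m (B : 'M[R]_(m, k)) (S : 'M[R]_k) :
  possemidef S -> possemidef (B *m S *m B^T).
Proof.
move=> [Ssym S0]; split; first by rewrite !trmx_mul trmxK Ssym mulmxA.
by move=> x; have := S0 (B^T *m x); rewrite trmx_mul trmxK !mulmxA.
Qed.

Lemma possemidefD k (S1 S2 : 'M[R]_k) :
  possemidef S1 -> possemidef S2 -> possemidef (S1 + S2).
Proof.
move=> [s1 p1] [s2 p2]; split; first by rewrite linearD/= s1 s2.
by move=> x; rewrite mulmxDr mulmxDl mxE addr_ge0.
Qed.

Lemma posdef_unitmx k (S : 'M[R]_k) : posdef S -> S \in unitmx.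
Proof.
move=> [Ssym S0]; rewrite -row_free_unit -kermx_eq0.
apply/eqP/row_matrixP => i; rewrite row0; set x := row i _.
have xS : x *m S = 0 by rewrite /x -row_mul mulmx_ker row0.
apply: trmx_inj; rewrite trmx0; apply/eqP/negPn/negP => /S0.
by rewrite trmxK xS mul0mx mxE ltxx.
Qed.

Lemma posdef_possemidef k (S : 'M[R]_k) : posdef S -> possemidef S.
Proof.
move=> [Ssym S0]; split=> // x; have [->|/S0/ltW//] := eqVneq x 0.
by rewrite mulmx0 mxE.
Qed.

Lemma posdef_inv k (S : 'M[R]_k) : posdef S -> posdef (invmx S).
Proof.
move=> pS; have uS := posdef_unitmx pS; have [Ssym S0] := pS.
split; first by rewrite trmx_inv Ssym.
move=> x x0; have y0 : invmx S *m x != 0.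
  apply: contra x0 => /eqP y0.
  by rewrite -(mulKVmx uS x) y0 mulmx0.
have := S0 _ y0.
by rewrite trmx_mul trmx_inv Ssym -!mulmxA mulKVmx.
Qed.

(** The Penrose equations are stable under transposition, and their solution is
    unique. *)
Lemma pinvMP_sym k (S : 'M[R]_k) : S^T = S -> (pinvMP S)^T = pinvMP S.
Proof.
move=> Ssym; apply: (@is_pinv_uniq _ _ _ S); last exact: pinvMPP.
have [SXS XSX SXs XSs] := pinvMPP S.
have SXt : S *m (pinvMP S)^T = pinvMP S *m S by rewrite -{1}Ssym -trmx_mul.
have XtS : (pinvMP S)^T *m S = S *m pinvMP S by rewrite -{2}Ssym -trmx_mul.
split.
- by rewrite -{1 3}Ssym -!trmx_mul mulmxA SXS.
- by rewrite -{2}Ssym -!trmx_mul mulmxA XSX.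
- by rewrite SXt XSs.
- by rewrite XtS SXs.
Qed.

(** For symmetric S, the pseudoinverse is S^+ S (S^+)^T, a congruence of S. *)
Lemma possemidef_pinvMP k (S : 'M[R]_k) :
  possemidef S -> possemidef (pinvMP S).
Proof.
move=> pS; have [Ssym _] := pS; have [_ XSX _ _] := pinvMPP S.
by rewrite -XSX -{2}(pinvMP_sym Ssym); exact: possemidef_congr.
Qed.

Lemma eigvec_quad k (C A : 'M[R]_k) (w : 'cV_k) (a : R) :
  C *m A *m w = a *: w ->
  w^T *m A *m C *m A *m w = a *: (w^T *m A *m w).
Proof. by move=> Cw; rewrite -!mulmxA (mulmxA C) Cw -!scalemxAr. Qed.

(** The nonnegative number w^T A C A w is the eigenvalue times w^T A w. *)
Lemma psd_eigval_ge0 k (C A : 'M[R]_k) (w : 'cV_k) (a : R) :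
  possemidef C -> A^T = A -> 0 < (w^T *m A *m w) 0 0 ->
  C *m A *m w = a *: w -> 0 <= a.
Proof.
move=> [_ C0] As wAw Cw; have := C0 (A *m w).
by rewrite trmx_mul As !mulmxA (eigvec_quad Cw) mxE pmulr_lge0.
Qed.

(** The intertwining (I + A C) A = A (I + C A) passes to inverses: the update
    matrix is self-adjoint for the form A, although it is not symmetric. *)
Lemma resolvent_adjoint k (C A : 'M[R]_k) :
  C^T = C -> A^T = A -> 1%:M + C *m A \in unitmx ->
  (invmx (1%:M + C *m A))^T *m A = A *m invmx (1%:M + C *m A).
Proof.
move=> Cs As u; set B := 1%:M + _.
have uBT : B^T \in unitmx by rewrite unitmx_tr.
have AB : B^T *m A = A *m B.
  by rewrite /B linearD/= trmx1 trmx_mul Cs As mulmxDl mulmxDr mul1mx mulmx1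
    mulmxA.
by rewrite trmx_inv -[A in RHS](mulKmx uBT) AB -!mulmxA (mulmxV u) mulmx1.
Qed.

Lemma gram_entry k m p (A : 'M[R]_k) (U : 'M[R]_(k, m)) (V : 'M[R]_(k, p)) a b :
  (U^T *m A *m V) a b = ((col a U)^T *m A *m col b V) 0 0.
Proof. by rewrite tr_col -row_mul (colE b V) mulmxA -row_mul -colE !mxE. Qed.

(** u^T A C A v can be read both as a (u^T A v) and as 0. *)
Lemma eigvec_orthogonal k (C A : 'M[R]_k) (u v : 'cV_k) (a : R) :
  C^T = C -> A^T = A -> a != 0 -> C *m A *m u = a *: u ->
  C *m A *m v = 0 -> u^T *m A *m v = 0.
Proof.
move=> Cs As a0 Cu Cv; apply: (scalerI a0); rewrite scaler0 2!scalemxAl.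
have -> : a *: u^T = (C *m A *m u)^T by rewrite Cu linearZ.
rewrite !trmx_mul As Cs -!mulmxA.
by rewrite (mulmxA C) Cv !mulmx0.
Qed.

(** One step of the covariance recursion tested on A w.  When A w is an
    eigenvector of N^T, each summand contributes the square of an eigenvalue, and
    A X A = A removes the pseudoinverse X from the second one. *)
Lemma damped_cov_quad k (N S X A : 'M[R]_k) (w : 'cV_k) (p : R) :
  A^T = A -> A *m X *m A = A -> N^T *m (A *m w) = p *: (A *m w) ->
  w^T *m A *m (N *m S *m N^T + (1%:M - N) *m X *m (1%:M - N)^T) *m A *m w =
  p ^+ 2 *: (w^T *m A *m S *m A *m w) + (1 - p) ^+ 2 *: (w^T *m A *m w).
Proof.
move=> As AXA Np.
have quad (B Q : 'M[R]_k) (q : R) : B^T *m (A *m w) = q *: (A *m w) ->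
    w^T *m A *m (B *m Q *m B^T) *m A *m w = q ^+ 2 *: (w^T *m A *m Q *m A *m w).
  move=> Bq; transitivity ((B^T *m (A *m w))^T *m Q *m (B^T *m (A *m w))).
    by rewrite !trmx_mul trmxK As !mulmxA.
  have -> : (B^T *m (A *m w))^T = q *: (w^T *m A).
    by rewrite Bq linearZ/= trmx_mul As.
  by rewrite Bq -!scalemxAl -scalemxAr scalerA !mulmxA.
have Np' : (1%:M - N)^T *m (A *m w) = (1 - p) *: (A *m w).
  by rewrite linearB/= trmx1 mulmxBl mul1mx Np scalerBl scale1r.
have := quad _ X _ Np'; have := quad _ S _ Np.
move: (N *m S *m N^T) ((1%:M - N) *m X *m _) => Y Z YE ZE.
rewrite mulmxDr !mulmxDl YE ZE.
by congr (_ + _ *: (_ *m _)); rewrite -[in RHS]AXA !mulmxA.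
Qed.

Lemma eigenbasis_diag k (X W : 'M[R]_k) (c : 'I_k -> R) :
  (forall l, X *m col l W = c l *: col l W) ->
  X *m W = W *m diag_mx (\row_l c l).
Proof.
move=> Xw; apply/matrixP => a l; have /colP/(_ a) := Xw l.
by rewrite (colE l W) mulmxA -!colE mul_mx_diag !mxE mulrC.
Qed.

End PositiveMatrices.

(** * The matrix H^T G^-1 H *)

Section ObservationInformation.
Context {R : realType} {n d : nat} (H : 'M[R]_(n, d)) (G : 'M[R]_n).
Hypothesis pG : posdef G.

Lemma possemidef_obs_info : possemidef (obs_info H G).
Proof.
have := possemidef_congr H^T (posdef_possemidef (posdef_inv pG)).
by rewrite trmxK.
Qed.

(** The quadratic form of A at x is that of the definite G^-1 at H x. *)
Lemma obs_info_isotropic (x : 'cV[R]_d) :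
  (x^T *m obs_info H G *m x) 0 0 = 0 -> obs_info H G *m x = 0.
Proof.
move=> x0; suff Hx : H *m x = 0 by rewrite /obs_info -mulmxA Hx mulmx0.
have [s p] := posdef_inv pG.
apply/eqP/negPn/negP => /p; move: x0.
by rewrite /obs_info trmx_mul !mulmxA => ->; rewrite ltxx.
Qed.

(** The covariance of the randomized maximum likelihood estimator: G cancels
    between the two weights G^-1, leaving A^+ A A^+ = A^+. *)
Lemma wpinv_cov : wpinv H G *m G *m (wpinv H G)^T = pinvMP (obs_info H G).
Proof.
have [Asym _] := possemidef_obs_info; have [Gsym _] := pG.
have uG := posdef_unitmx pG; have [_ XAX _ _] := pinvMPP (obs_info H G).
rewrite /wpinv !trmx_mul trmxK trmx_inv Gsym (pinvMP_sym Asym).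
by rewrite (mulmxKV uG) -[RHS]XAX /obs_info !mulmxA.
Qed.

End ObservationInformation.

(** * The mean-field recursion in the eigenbasis *)

Section Dynamics.
Context {R : realType} {n d : nat}.
Variables (H : 'M[R]_(n, d)) (G : 'M[R]_n) (C0 : 'M[R]_d).
Hypotheses (pG : posdef G) (pC0 : possemidef C0).
Variables (W : 'M[R]_d) (lam : nat -> 'I_d -> R) (r : nat) (hr : (r <= d)%N).
Hypothesis eigW : mf_eigensystem H G C0 W lam hr.

Local Notation A := (obs_info H G).
Local Notation w l := (col l W).
Local Notation C := (mf_cov H G C0).
Local Notation N := (mf_prod H G C0).

Lemma mf_cov_possemidef i : possemidef (C i).
Proof.
case: i => [|i]; first by rewrite mf_cov0.
rewrite mf_covS; apply: possemidefD; apply: possemidef_congr => //.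
exact/possemidef_pinvMP/possemidef_obs_info.
Qed.

Lemma eigvec_neq0 l : w l != 0.
Proof.
apply/eqP => wl0; have := mulVmx (eigen_basis eigW).
move/(congr1 (col l)); rewrite colE -mulmxA -colE wl0 mulmx0.
move/colP/(_ l); rewrite !mxE eqxx => /eqP.
by rewrite eq_sym oner_eq0.
Qed.

(** The eigenvalue is a quotient of two nonnegative quadratic forms, unless
    w_l^T A w_l = 0; then A w_l = 0 and the eigenvalue vanishes. *)
Lemma eigval_ge0 i l : 0 <= lam i l.
Proof.
have [Asym Age0] := possemidef_obs_info H pG.
have := Age0 (w l); rewrite le_eqVlt.
move=> /predU1P[/esym/(obs_info_isotropic pG) Aw|Aw].
  have := eigen_eq eigW i l; rewrite -mulmxA Aw mulmx0 => /esym/eqP.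
  by rewrite scaler_eq0 (negbTE (eigvec_neq0 l)) orbF => /eqP ->.
exact: (psd_eigval_ge0 (mf_cov_possemidef i) Asym Aw (eigen_eq eigW i l)).
Qed.

(** The first r eigenvalues are positive and exactly r of them are, so the
    remaining ones are nonpositive. *)
Lemma eigval_eq0 i (l : 'I_d) : (r <= l)%N -> lam i l = 0.
Proof.
move=> rl; apply/eqP; rewrite eq_le eigval_ge0 andbT leNgt.
pose S := [set k : 'I_d | (k < r)%N]%SET.
have cS : #|S| = r.
  have wI : injective (widen_ord hr).
    by move=> x x' /(congr1 (@nat_of_ord d)) /= ?; exact: val_inj.
  rewrite -[RHS](card_ord r) -cardsT -(card_imset _ wI).
  apply: eq_card => k; rewrite inE; apply/idP/imsetP => [kr|[k' _ ->]] /=.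
    by exists (Ordinal kr); [rewrite inE|exact: val_inj].
  exact: ltn_ord.
have SP : S = [set k : 'I_d | 0 < lam i k]%SET.
  apply/eqP; rewrite eqEcard cS (eigen_count eigW i) leqnn andbT.
  by apply/fintype.subsetP => k; rewrite !inE; exact: (eigen_pos eigW).
apply/negP => lpos; have : l \in S by rewrite SP inE.
by rewrite inE ltnNge rl.
Qed.

Lemma one_plus_eigval_gt0 i l : 0 < 1 + lam i l.
Proof. by rewrite ltr_wpDr// eigval_ge0. Qed.

Lemma step_inv_eigvec i l :
  (1%:M + C i *m A) *m w l = (1 + lam i l) *: w l.
Proof. by rewrite mulmxDl mul1mx (eigen_eq eigW) scalerDl scale1r. Qed.

Lemma step_unitmx i : 1%:M + C i *m A \in unitmx.
Proof.
suff : (1%:M + C i *m A) *m W \in unitmx by rewrite unitmx_mul => /andP[].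
rewrite (eigenbasis_diag (step_inv_eigvec i)).
rewrite unitmx_mul (eigen_basis eigW)/= unitmxE det_diag unitfE.
by apply/prodf_neq0 => l _; rewrite mxE gt_eqF// one_plus_eigval_gt0.
Qed.

Definition decay i l : R := \prod_(k < i.+1) (1 + lam k l)^-1.

Lemma decayS i l : decay i.+1 l = decay i l * (1 + lam i.+1 l)^-1.
Proof. by rewrite /decay big_ord_recr. Qed.

Lemma decay0 l : decay 0 l = (1 + lam 0%N l)^-1.
Proof. by rewrite /decay big_ord1. Qed.

Lemma decay_ge0 i l : 0 <= decay i l.
Proof. by apply: prodr_ge0 => k _; rewrite invr_ge0 ltW ?one_plus_eigval_gt0. Qed.

Lemma step_eigvec i l :
  mf_step H G C0 i *m w l = (1 + lam i l)^-1 *: w l.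
Proof.
apply: (scalerI (lt0r_neq0 (one_plus_eigval_gt0 i l))).
rewrite scalerA divff ?lt0r_neq0 ?one_plus_eigval_gt0// scale1r.
by rewrite scalemxAr -step_inv_eigvec /mf_step mulKmx// step_unitmx.
Qed.

Lemma prod_eigvec i l : N i *m w l = decay i l *: w l.
Proof.
elim: i => [|i IH]; first by rewrite mf_prod0 step_eigvec decay0.
by rewrite mf_prodS -mulmxA IH -scalemxAr step_eigvec scalerA decayS.
Qed.

Lemma step_adjoint i :
  (mf_step H G C0 i)^T *m A = A *m mf_step H G C0 i.
Proof.
have [As _] := possemidef_obs_info H pG.
have [Cs _] := mf_cov_possemidef i.
exact: (resolvent_adjoint Cs As (step_unitmx i)).
Qed.

(** The transposed factors act in the opposite order, but each of them is scalar
    on A w_l. *)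
Lemma prodT_eigvec i l : (N i)^T *m (A *m w l) = decay i l *: (A *m w l).
Proof.
elim: i => [|i IH]; rewrite ?mf_prod0 ?mf_prodS ?trmx_mul.
  by rewrite (mulmxA _ A) step_adjoint -mulmxA step_eigvec -scalemxAr decay0.
rewrite -mulmxA (mulmxA _ A) step_adjoint -mulmxA step_eigvec -2!scalemxAr IH.
by rewrite scalerA decayS mulrC.
Qed.

Lemma eigvec_normalized (l : 'I_d) : (l < r)%N ->
  (w l)^T *m A *m w l = 1%:M.
Proof.
move=> lr; have /matrixP/(_ (Ordinal lr) (Ordinal lr)) := eigen_normalized eigW.
rewrite gram_entry [in RHS]mxE eqxx.
have -> : col (Ordinal lr) (leading_cols hr W) = w l.
  by apply/colP => k; rewrite !mxE; congr (W k _); exact: val_inj.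
by move=> E; apply/matrixP => a b; rewrite !ord1 E mxE.
Qed.

(** The rows of U^T A are the forms u_k^T A with lam 0 k > 0, while
    C_0 A w_l = 0, so A-orthogonality of eigenvectors applies. *)
Lemma proj_eigvec (l : 'I_d) : (r <= l)%N ->
  mf_proj H G (leading_cols hr W) *m w l = 0.
Proof.
move=> rl; have [As _] := possemidef_obs_info H pG.
rewrite /mf_proj -2!(mulmxA (leading_cols hr W)).
suff -> : (leading_cols hr W)^T *m A *m w l = 0 by rewrite mulmx0.
apply/matrixP => a b; rewrite gram_entry col_id ord1.
have -> : col a (leading_cols hr W) = w (widen_ord hr a).
  by apply/colP => k; rewrite !mxE.
rewrite (@eigvec_orthogonal _ _ C0 _ _ _ (lam 0 (widen_ord hr a))) ?mxE//.
- by case: pC0.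
- by rewrite gt_eqF// (eigen_pos eigW)/=.
- exact: (eigen_eq eigW 0).
- by have := eigen_eq eigW 0 l; rewrite eigval_eq0// scale0r.
Qed.

(** The scalar form of the covariance recursion: it makes lam (i+1) l bounded
    below in terms of decay alone. *)
Lemma eigval_rec i (l : 'I_d) : (l < r)%N ->
  lam i.+1 l = decay i l ^+ 2 * lam 0 l + (1 - decay i l) ^+ 2.
Proof.
move=> lr; have [As _] := possemidef_obs_info H pG.
have [AXA _ _ _] := pinvMPP A.
have quad k : (w l)^T *m A *m C k *m A *m w l = (lam k l)%:M.
  by rewrite (eigvec_quad (eigen_eq eigW k l)) eigvec_normalized//
    scale_scalar_mx mulr1.
have := damped_cov_quad C0 As AXA (prodT_eigvec i l).
rewrite -mf_covS quad -[C0]/(C 0) quad eigvec_normalized// => /matrixP/(_ 0 0).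
by rewrite !mxE eqxx !mulr1n mulr1.
Qed.

Lemma decay_id i (l : 'I_d) : (r <= l)%N -> decay i l = 1.
Proof.
by move=> rl; rewrite /decay big1// => k _; rewrite eigval_eq0// addr0 invr1.
Qed.

Lemma decay_le_first i l : decay i l <= decay 0 l.
Proof.
elim: i => // i; apply: le_trans; rewrite decayS ler_piMr ?decay_ge0//.
by rewrite invf_le1 ?one_plus_eigval_gt0// lerDl eigval_ge0.
Qed.

Lemma decay_le1 i l : decay i l <= 1.
Proof.
apply: (le_trans (decay_le_first _ _)).
by rewrite decay0 invf_le1 ?one_plus_eigval_gt0// lerDl eigval_ge0.
Qed.

(** Because decay i l <= decay 0 l < 1, the recursion keeps every later
    eigenvalue above c = (1 - decay 0 l)^2, so each further factor of decay is at
    most 1 / (1 + c). *)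
Lemma decay_cvg0 (l : 'I_d) : (l < r)%N -> decay i l @[i --> \oo] --> (0 : R).
Proof.
move=> lr; set c := (1 - decay 0 l) ^+ 2.
have c0 : 0 < c.
  rewrite exprn_gt0// subr_gt0 decay0 invf_lt1 ?one_plus_eigval_gt0// ltrDl.
  exact: (eigen_pos eigW).
have lamc i : c <= lam i.+1 l.
  rewrite eigval_rec// ler_wpDl ?mulr_ge0 ?exprn_ge0 ?eigval_ge0 ?decay_ge0//.
  by rewrite lerXn2r ?nnegrE ?subr_ge0 ?decay_le1// lerD2l lerN2 decay_le_first.
have c1 : 0 < 1 + c by rewrite addr_gt0.
have bnd i : decay i l <= (1 + c)^-1 ^+ i.
  elim: i => [|i IH].
    by rewrite expr0 decay_le1.
  rewrite decayS exprSr ler_pM ?decay_ge0 ?invr_ge0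
    ?(ltW (one_plus_eigval_gt0 _ _))//.
  by rewrite lef_pV2 ?posrE ?one_plus_eigval_gt0// lerD2l.
apply: (@squeeze_cvgr _ _ _ _ (fun=> 0) (fun i => (1 + c)^-1 ^+ i)).
- by apply: nearW => i; rewrite decay_ge0 bnd.
- exact: cvg_cst.
- apply: cvg_expr; rewrite ger0_norm ?invr_ge0 ?ltW//.
  by rewrite invf_lt1// ltrDl.
Qed.

Lemma decay_cvg (l : 'I_d) :
  decay i l @[i --> \oo] --> ((r <= l)%N%:R : R).
Proof.
have [rl|lr] := leqP r l; last exact: decay_cvg0.
rewrite (_ : (fun i => decay i l) = fun=> 1); first exact: cvg_cst.
by apply/funext => i; rewrite decay_id.
Qed.

Lemma mf_particleE (v0 vs : 'cV[R]_d) i :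
  mf_particle H G C0 v0 vs i.+1 =
  vs + \sum_(l < d) (decay i l * (invmx W *m (v0 - vs)) l 0) *: w l.
Proof.
rewrite /mf_particle mulmxBl mul1mx addrCA -mulmxBr; congr (_ + _).
rewrite -{1}(mulKVmx (eigen_basis eigW) (v0 - vs)); set c := invmx W *m _.
have -> : W *m c = \sum_(l < d) c l 0 *: w l.
  apply/colP => a; rewrite !mxE summxE; apply: eq_bigr => l _.
  by rewrite !mxE mulrC.
rewrite mulmx_sumr; apply: eq_bigr => l _.
by rewrite -scalemxAr prod_eigvec scalerA mulrC.
Qed.

Definition mf_limit (v0 vs : 'cV[R]_d) : 'cV[R]_d :=
  vs + \sum_(l < d) ((r <= l)%N%:R * (invmx W *m (v0 - vs)) l 0) *: w l.

(** Stated after multiplication by a matrix K, so that both the particles (K = I)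
    and their projections are covered: K acts on the fixed vectors of the
    eigenbasis expansion, and only the scalar factors depend on i. *)
Lemma cvg_mf_particle m (K : 'M[R]_(m, d)) (v0 vs : 'cV[R]_d) :
  K *m mf_particle H G C0 v0 vs i.+1 @[i --> \oo] --> K *m mf_limit v0 vs.
Proof.
rewrite /mf_limit mulmxDr mulmx_sumr.
rewrite (_ : (fun i => _) = fun i => K *m vs +
    \sum_(l < d) (decay i l * (invmx W *m (v0 - vs)) l 0) *: (K *m w l));
  last first.
  apply/funext => i; rewrite mf_particleE mulmxDr mulmx_sumr; congr (_ + _).
  by apply: eq_bigr => l _; rewrite scalemxAr.
apply: cvgD; first exact: cvg_cst.
apply: cvg_big => [|l _]; first exact: add_continuous.
rewrite -scalemxAr; apply: cvgZr_tmp.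
by apply: cvgMr_tmp; exact: decay_cvg.
Qed.

Lemma proj_mf_limit (v0 vs : 'cV[R]_d) :
  mf_proj H G (leading_cols hr W) *m mf_limit v0 vs =
  mf_proj H G (leading_cols hr W) *m vs.
Proof.
rewrite /mf_limit mulmxDr mulmx_sumr big1 ?addr0// => l _.
rewrite -scalemxAr; have [rl|_] := leqP r l; last by rewrite mul0r scale0r.
by rewrite proj_eigvec// scaler0.
Qed.

End Dynamics.

(** * Translation of Gaussian laws on the line *)

Section GaussianShift.
Context {R : realType}.
Local Notation mu := (@lebesgue_measure R).

Lemma lebesgue_measure_shift (c : R) (A : set R) : measurable A ->
  pushforward mu ((fun x => x + c) : _ -> measurableTypeR R) A = mu A.
Proof.
have mc : measurable_fun [set: measurableTypeR R]
    ((fun x => x + c) : _ -> measurableTypeR R).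
  by apply: measurable_funD => //; exact: measurable_cst.
pose mc' := isMeasurableFun.Build _ _ _ _ _ mc.
pose f : {mfun measurableTypeR R >-> measurableTypeR R} :=
  HB.pack (fun x : R => x + c) mc'.
move=> mA; apply/esym.
apply: (@lebesgue_measure_unique _ (pushforward mu f)) => //= _ [[a b]] _ <-.
rewrite /pushforward.
rewrite (_ : _ @^-1` _ = `](a - c), (b - c)]%classic); last first.
  by apply/seteqP; split => x /=; rewrite !in_itv/= ltrBlDr lerBrDr.
rewrite !lebesgue_measure_itv/= !lte_fin ltrD2r; case: ifPn => // _.
by rewrite -!EFinB opprB addrA subrK.
Qed.

(** At s = 0 the density is by convention the indicator of [0, 1] whatever the
    mean, and the translation property fails. *)
Lemma normal_prob_shift (m c s : R) (B : set R) : s != 0 -> measurable B ->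
  normal_prob m s [set x | B (x + c)] = normal_prob (m + c) s B.
Proof.
move=> s0 mB; rewrite /normal_prob.
have mc : measurable_fun [set: measurableTypeR R]
    ((fun x => x + c) : _ -> measurableTypeR R).
  by apply: measurable_funD => //; exact: measurable_cst.
pose mc' := isMeasurableFun.Build _ _ _ _ _ mc.
pose f : {mfun measurableTypeR R >-> measurableTypeR R} :=
  HB.pack (fun x : R => x + c) mc'.
transitivity (\int[pushforward mu f]_(x in B) (normal_pdf (m + c) s x)%:E)%E.
  rewrite ge0_integral_pushforward//.
  - apply: eq_integral => x _ /=; rewrite !normal_pdfE// /normal_fun.
    by rewrite opprD addrACA subrr addr0.
  - apply/measurable_EFinP; apply: measurable_funTS.
    exact: measurable_normal_pdf.
  - by move=> x _; rewrite lee_fin normal_pdf_ge0.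
by apply: eq_measure_integral => /= A mA _; exact: lebesgue_measure_shift.
Qed.

Lemma gauss1_shift (m c v : R) (B : set R) : 0 <= v -> measurable B ->
  gauss1 m v [set x | B (x + c)] = gauss1 (m + c) v B.
Proof.
move=> v0 mB; rewrite /gauss1; case: ifPn => [_|vN0]; last first.
  by rewrite normal_prob_shift// sqrtr_eq0 -ltNge lt_def vN0.
by rewrite !diracE; congr ((nat_of_bool _)%:R%:E).
Qed.

End GaussianShift.

(** * Borel measurability of vector-valued maps *)

Section BorelVectors.
Context {disp : measure_display} {T : measurableType disp} {R : realType}.

Lemma continuous_measurable_Rvec k (f : 'cV[R]_k -> R) : continuous f ->
  measurable_fun [set: Rvec R k] (f : Rvec R k -> R).
Proof.
move=> /continuousP cf.
apply: (@measurability _ _ (Rvec R k) _ setT f _ (RGenOpens.measurableE R)).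
move=> _ [_ [a [b ->]] <-]; rewrite setTI; apply: sub_sigma_algebra.
by apply: cf; exact: interval_open.
Qed.

Lemma measurable_Rvec_coord k (f : T -> Rvec R k) (a : 'I_k) :
  measurable_fun [set: T] f ->
  measurable_fun [set: T] (fun w => (f w : 'cV[R]_k) a 0).
Proof.
move=> mf.
pose coord (x : Rvec R k) : R := (x : 'cV[R]_k) a 0.
apply: (measurableT_comp (f := coord) _ mf).
by apply: continuous_measurable_Rvec; exact: coord_continuous.
Qed.

(** The topology of R^k has a countable base of balls with rational centers and
    radii 1/(n+1); for the sup norm a ball is a box, whose preimage is a finite
    intersection of coordinate preimages. *)
Lemma measurable_fun_Rvec k (f : T -> Rvec R k) :
  (forall a, measurable_fun [set: T] (fun w => (f w : 'cV[R]_k) a 0)) ->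
  measurable_fun [set: T] f.
Proof.
move=> mf; apply: (@measurability _ _ T (Rvec R k) setT f (@open 'cV[R]_k) erefl).
move=> _ [U oU <-]; rewrite setTI.
pose q (p : 'cV[rat]_k) : 'cV[R]_k := map_mx ratr p.
pose D := [set p : 'cV[rat]_k * nat | ball (q p.1) p.2.+1%:R^-1 `<=` U].
have -> : f @^-1` U =
    \bigcup_(p in D) f @^-1` ball (q p.1 : 'cV[R]_k) (p.2.+1%:R^-1 : R).
  apply/seteqP; split=> [w Uw|w [p Dp] /= fw]; last exact: Dp.
  have [e /= e0 eU] : nbhs_ball (f w : 'cV[R]_k) U.
    by apply/nbhs_ballP; exact: open_nbhs_nbhs.
  (* The radius is at most e / 2, so that a ball of that radius containing f w
     lies inside the ball of radius e around f w. *)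
  pose N := Num.truncn (2 / e); pose dl : R := N.+1%:R^-1.
  have dl0 : 0 < dl by rewrite invr_gt0.
  have dle : dl + dl <= e.
    rewrite -mulr2n -mulr_natl -ler_pdivlMl// mulrC -invf_div
      lef_pV2 ?posrE ?divr_gt0//.
    exact/ltW/truncnS_gt.
  have near_rat a : exists c : rat, ball (ratr c : R) dl ((f w : 'cV[R]_k) a 0).
    have : (f w : 'cV[R]_k) a 0 < (f w : 'cV[R]_k) a 0 + dl by rewrite ltrDl.
    move=> /rat_in_itvoo[c]; rewrite in_itv/= => /andP[c1 c2].
    by exists c; rewrite /ball/= ger0_norm ?subr_ge0 ?(ltW c1)// ltrBlDl.
  have [c cP] := choice near_rat.
  have fwc : ball (q (\col_a c a)) dl (f w : 'cV[R]_k).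
    by split=> // a b; rewrite ord1 !mxE; exact: cP.
  exists (\col_a c a, N) => //=.
  move=> z qz; apply: eU; apply: (le_ball dle).
  exact: (ball_triangle (ball_sym fwc) qz).
rewrite bigcup_mkcond.
apply: countable_bigcupT_measurable => [|p]; first exact: countableP.
case: ifPn => // _.
have -> : f @^-1` ball (q p.1 : 'cV[R]_k) (p.2.+1%:R^-1 : R) =
   \bigcap_(a in [set: 'I_k])
     (fun w => (f w : 'cV[R]_k) a 0) @^-1` ball (q p.1 a 0) (p.2.+1%:R^-1).
  apply/seteqP; split=> [w [_ fw] a _|w fw]; first exact: fw.
  split=> [|a b]; first by rewrite invr_gt0.
  by rewrite ord1; exact: fw.
apply: fin_bigcap_measurable => // a _; rewrite -[X in measurable X]setTI.
by apply: mf => //; apply: open_measurable; exact: ball_open.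
Qed.

Lemma measurable_fun_mulmx k m (K : 'M[R]_(m, k)) (f : T -> Rvec R k) :
  measurable_fun [set: T] f ->
  measurable_fun [set: T] ((fun w => K *m (f w : 'cV[R]_k)) : T -> Rvec R m).
Proof.
move=> mf; apply: measurable_fun_Rvec => a.
under eq_fun do rewrite mxE.
apply: measurable_sum => b; apply: measurable_funM; first exact: measurable_cst.
exact: measurable_Rvec_coord.
Qed.

Lemma measurable_fun_addmx k (f g : T -> Rvec R k) :
  measurable_fun [set: T] f -> measurable_fun [set: T] g ->
  measurable_fun [set: T]
    ((fun w => (f w : 'cV[R]_k) + (g w : 'cV[R]_k)) : T -> Rvec R k).
Proof.
move=> mf mg; apply: measurable_fun_Rvec => a.
under eq_fun do rewrite mxE.
by apply: measurable_funD; exact: measurable_Rvec_coord.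
Qed.

End BorelVectors.

(** * Gaussian laws and convergence in distribution *)

Section Laws.
Context {disp : measure_display} {T : measurableType disp} {R : realType}.
Variable P : probability T R.

(** A functional a of K X + c is the functional K^T a of X shifted by the
    constant a^T c. *)
Lemma gaussian_law_affine k m (X : {RV P >-> Rvec R k}) (Y : {RV P >-> Rvec R m})
    (mu : 'cV[R]_k) (S : 'M[R]_k) (K : 'M[R]_(m, k)) (c : 'cV[R]_m) :
  possemidef S -> gaussian_law (distribution P X) mu S ->
  (forall w, (Y w : 'cV[R]_m) = K *m (X w : 'cV[R]_k) + c) ->
  gaussian_law (distribution P Y) (K *m mu + c) (K *m S *m K^T).
Proof.
move=> [_ S0] lawX YE a B mB; pose b := K^T *m a.
have bE : b^T = a^T *m K by rewrite trmx_mul trmxK.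
have -> : a^T *m (K *m S *m K^T) *m a = b^T *m S *m b by rewrite bE !mulmxA.
have -> : (a^T *m (K *m mu + c)) 0 0 = (b^T *m mu) 0 0 + (a^T *m c) 0 0.
  by rewrite bE mulmxDr mxE mulmxA.
rewrite -gauss1_shift// -lawX; last first.
  rewrite -[X in measurable X]setTI.
  have mD : measurable_fun [set: R] (fun x : R => x + (a^T *m c) 0 0).
    by apply: measurable_funD => //; exact: measurable_cst.
  exact: mD.
change (P [set w | B ((a^T *m (Y w : 'cV[R]_m)) 0 0)] =
  P [set w | B ((b^T *m (X w : 'cV[R]_k)) 0 0 + (a^T *m c) 0 0)]).
congr (P _); apply/funext => w /=.
by rewrite YE bE mulmxDr mxE mulmxA.
Qed.

(** A bounded continuous f turns pointwise convergence into bounded pointwise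
    convergence, to which dominated convergence applies. *)
Lemma cvg_pointwise_in_distribution k (X : nat -> T -> 'cV[R]_k)
    (Y : {RV P >-> Rvec R k}) :
  (forall i, measurable_fun [set: T] (X i : T -> Rvec R k)) ->
  (forall w, X i w @[i --> \oo] --> (Y w : 'cV[R]_k)) ->
  cvg_in_distribution P X (distribution P Y).
Proof.
move=> mX XY; split=> // f cf [M fM].
have mf : measurable_fun [set: Rvec R k] (f : Rvec R k -> R).
  exact: continuous_measurable_Rvec.
have mfY : measurable_fun [set: T] (fun w => f (Y w)).
  exact: (measurableT_comp mf).
have mfX i : measurable_fun [set: T] (fun w => f (X i w)).
  exact: (measurableT_comp mf (mX i)).
have iM : P.-integrable [set: T] (EFin \o cst M).
  exact: finite_measure_integrable_cst.
rewrite integral_pushforward//; last first.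
- apply: le_integrable iM => //; first exact/measurable_EFinP.
  by move=> w _ /=; rewrite lee_fin (le_trans (fM _))// ler_norm.
- exact/measurable_EFinP.
have [|||||_ _] := @dominated_convergence _ T R P [set: T] measurableT
  (fun i w => (f (X i w))%:E) (fun w => (f (Y w))%:E) (EFin \o cst M).
- by move=> i; exact/measurable_EFinP.
- exact/measurable_EFinP.
- apply: aeW => w _; apply: cvg_EFin; first exact: nearW.
  by apply: continuous_cvg; [exact: cf|exact: XY].
- exact: iM.
- by apply: aeW => w i _ /=; rewrite lee_fin.
by [].
Qed.

End Laws.


(** * Convergence of the projected particles *)

Theorem corollary3p7 (R : realType) (n d J : nat)
    (H : 'M[R]_(n, d)) (G : 'M[R]_n) (y : 'cV[R]_n)
    (mu0 : 'cV[R]_d) (C0 : 'M[R]_d)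
    (hG : posdef G) (hC0 : possemidef C0)
    (disp : measure_display) (T : measurableType disp) (P : probability T R)
    (v0 : 'I_J -> {RV P >-> Rvec R d}) (eps : 'I_J -> {RV P >-> Rvec R n})
    (hmean : forall j, has_mean (v0 j) mu0)
    (hcov : forall j, has_covariance (v0 j) C0)
    (heps : forall j, gaussian_law (distribution P (eps j)) 0 G)
    (heps_indep : mutually_independent eps)
    (heps_v0 : independent_families eps v0)
    (W : 'M[R]_d) (lam : nat -> 'I_d -> R) (r : nat) (hr : (r <= d)%N)
    (hW : mf_eigensystem H G C0 W lam hr) :
  let Pr : 'M[R]_d := mf_proj H G (leading_cols hr W) in
  let vstar (j : 'I_J) (w : T) : 'cV[R]_d :=
    wpinv H G *m (y + (eps j w : 'cV[R]_n)) in
  let v (j : 'I_J) (i : nat) (w : T) : 'cV[R]_d :=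
    mf_particle H G C0 (v0 j w) (vstar j w) i in
  forall j : 'I_J,
    (forall w : T,
       cvg (v j i.+1 w @[i --> \oo]) /\
       (Pr *m v j i.+1 w @[i --> \oo] -->
          Pr *m lim (v j i.+1 w @[i --> \oo])) /\
       Pr *m lim (v j i.+1 w @[i --> \oo]) = Pr *m vstar j w) /\
    (exists nu : probability (Rvec R d) R,
       gaussian_law nu (Pr *m (wpinv H G *m y))
         (Pr *m pinvMP (obs_info H G) *m Pr^T) /\
       cvg_in_distribution P (fun i w => Pr *m v j i.+1 w) nu).
Proof.
move=> Pr vstar v j.
have cvgK m (K : 'M[R]_(m, d)) w : K *m v j i.+1 w @[i --> \oo] -->
    K *m mf_limit W r (v0 j w) (vstar j w).
  exact: (cvg_mf_particle hG hC0 hW).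
have cvgv w : v j i.+1 w @[i --> \oo] --> mf_limit W r (v0 j w) (vstar j w).
  by have := cvgK _ 1%:M w; under eq_fun do rewrite mul1mx; rewrite mul1mx.
have limv w : lim (v j i.+1 w @[i --> \oo]) = mf_limit W r (v0 j w) (vstar j w).
  exact: cvg_lim (cvgv w).
have Prlim w : Pr *m mf_limit W r (v0 j w) (vstar j w) = Pr *m vstar j w.
  exact: (proj_mf_limit hG hC0 hW).
split=> [w|].
  split; first exact: (cvgP _ (cvgv w)).
  by rewrite limv; split; [exact: cvgK|exact: Prlim].
pose K := Pr *m wpinv H G.
have mvstar : measurable_fun [set: T] (vstar j : T -> Rvec R d).
  apply: (measurable_fun_mulmx (wpinv H G)).
  by apply: measurable_fun_addmx => //; exact: measurable_cst.
have mX : measurable_fun [set: T] ((fun w => Pr *m vstar j w) : T -> Rvec R d).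
  exact: measurable_fun_mulmx.
pose X : {RV P >-> Rvec R d} :=
  HB.pack (fun w : T => (Pr *m vstar j w : Rvec R d))
    (isMeasurableFun.Build _ _ _ _ _ mX).
exists (distribution P X); split.
  have XE w : (X w : 'cV[R]_d) = K *m (eps j w : 'cV[R]_n) + K *m y.
    by rewrite -mulmxDr -mulmxA addrC.
  have := gaussian_law_affine (posdef_possemidef hG) (heps j) XE.
  rewrite mulmx0 add0r (_ : K *m G *m K^T = Pr *m pinvMP (obs_info H G) *m Pr^T).
    by rewrite mulmxA.
  by rewrite -(wpinv_cov H hG) /K trmx_mul !mulmxA.
apply: cvg_pointwise_in_distribution => [i|w]; last first.
  by rewrite /= -Prlim; exact: cvgK.
apply: measurable_fun_mulmx; apply: measurable_fun_addmx.
  exact: measurable_fun_mulmx.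
exact: measurable_fun_mulmx.
Qed.
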